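(* Let $X$ be an ergodic (irreducible and aperiodic) discrete-time homogeneous Markov chain on a finite state space $\mathcal{X}$ with transition matrix $P$, stationary distribution $\pi=(\pi_i)_{i\in\mathcal{X}}$ and resistance distance $\Omega=(\Omega_{i,j})_{i,j\in\mathcal{X}}$. Suppose that $X$ is reversible, and let $M$ be the diagonal matrix with $M_{i,i}=\pi_i$ for all $i\in\mathcal{X}$. Then for every integer $m\ge 1$, $$\sum_{i,j\in\mathcal{X}}\pi_j\,P^m_{j,i}\,\Omega_{i,j}=2\,\mathrm{Tr}\left(M\left(\sum_{l=0}^{m-1}(P^l-\Pi)\right)\right),$$ where $P^m_{j,i}$ is the $(j,i)$ entry of the matrix power $P^m$. In particular, if in addition $P$ is doubly stochastic (all row sums and all column sums equal $1$), then $$\sum_{i,j\in\mathcal{X}}P_{i,j}\,\Omega_{i,j}=2(|\mathcal{X}|-1).$$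
   Context: $\Pi$ is the $|\mathcal{X}|\times|\mathcal{X}|$ matrix each of whose rows is $\pi$, and $I$ is the identity matrix of the same size ($P^0=I$). The fundamental matrix of $X$ is $F=(F_{i,j})_{i,j\in\mathcal X}:=(I-P+\Pi)^{-1}$ (the inverse always exists). The resistance distance of the Markov chain is $\Omega_{i,j}:=F_{i,i}+F_{j,j}-F_{i,j}-F_{j,i}$ for $i,j\in\mathcal{X}$. The chain is reversible if it satisfies the detailed balance condition $\pi_iP_{i,j}=\pi_jP_{j,i}$ for all $i,j\in\mathcal{X}$. $\mathrm{Tr}$ denotes the trace. *)

(* Defs.v *)
From HB Require Import structures.
From mathcomp Require Import all_boot all_order all_algebra.
From mathcomp Require Import reals.

Set Implicit Arguments.
Unset Strict Implicit.
Unset Printing Implicit Defensive.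

Import Order.TTheory GRing.Theory Num.Theory.
Local Open Scope ring_scope.

(* A homogeneous Markov chain on a finite state space of size n is given by its
   transition matrix P : 'M[R]_n, with the states labelled by 'I_n.
   Distributions are row vectors. *)

Section MarkovChain.
Variables (R : realType) (n : nat).
Implicit Types (P : 'M[R]_n) (pi : 'rV[R]_n).

Definition stochastic P : Prop :=
  (forall i j, 0 <= P i j) /\ (forall i, \sum_j P i j = 1).

Definition irreducible P : Prop :=
  forall i j, exists k : nat, 0 < (P ^+ k) i j.

(* d is the greatest common divisor of the return times k >= 1 to i; the gcd of
   a possibly infinite set of naturals is given by its universal property. *)
Definition is_period P (i : 'I_n) (d : nat) : Prop :=
  forall e : nat,
    (e %| d)%N <-> (forall k : nat, (0 < k)%N -> 0 < (P ^+ k) i i -> (e %| k)%N).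

Definition aperiodic P : Prop := forall i, is_period P i 1.

Definition ergodic P : Prop := irreducible P /\ aperiodic P.

Definition distribution pi : Prop :=
  (forall i, 0 <= pi 0 i) /\ \sum_i pi 0 i = 1.

Definition stationary_distribution P pi : Prop :=
  distribution pi /\ pi *m P = pi.

Definition reversible P pi : Prop :=
  forall i j, pi 0 i * P i j = pi 0 j * P j i.

Definition doubly_stochastic P : Prop :=
  stochastic P /\ (forall j, \sum_i P i j = 1).

Definition Pi_mx pi : 'M[R]_n := \matrix_(i, j) pi 0 j.

(* invmx is a genuine inverse here: 1 - P + Pi_mx pi is a unit whenever P is
   stochastic and irreducible with stationary distribution pi. *)
Definition fundamental_mx P pi : 'M[R]_n := invmx (1%:M - P + Pi_mx pi).

Definition resistance_distance P pi (i j : 'I_n) : R :=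
  let F := fundamental_mx P pi in F i i + F j j - F i j - F j i.

End MarkovChain.

(* Main.v *)
Require Import Defs.
From HB Require Import structures.
From mathcomp Require Import all_boot all_order all_algebra.
From mathcomp Require Import reals.

Set Implicit Arguments.
Unset Strict Implicit.
Unset Printing Implicit Defensive.

Import Order.TTheory GRing.Theory Num.Theory.
Local Open Scope ring_scope.

(** Weighting the resistance distance by the flow [pi_j (P^m)_{j,i}] produces
    four sums.  Both marginals of the flow are [pi], because [P^m] is stochastic
    and fixes [pi]; hence the two diagonal terms of [Omega] each contribute
    [Tr (M F)].  Each off-diagonal term contributes [Tr (M P^m F)], one of them
    directly and the other because reversibility makes the flow symmetric.  The
    total is [2 Tr (M (I - P^m) F)].

    The matrix is now computed exactly.  As [pi F = pi], the fundamental matrix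
    satisfies [(I - P) F = I - Pi] (lemma [mulmx_generator_fundamental]);
    writing [I - P^m] as a geometric sum times [I - P], and using
    [P^l Pi = Pi], gives [(I - P^m) F = \sum_(l < m) (P^l - Pi)].

    All this needs [I - P + Pi] to be invertible (lemma
    [fundamental_unitmx]).  A vector [v] in its kernel satisfies [pi v = 0]
    (multiply by [pi] on the left), so [P v = v]; the maximum principle for
    irreducible chains makes [v] constant, and a constant of zero [pi]-mean
    vanishes.  The same invertibility shows that the stationary distribution is
    unique, so it is uniform for a doubly stochastic [P]; the last claim is
    then the case [m = 1] multiplied by [n]. *)

Section Chain.
Variables (R : realType) (n : nat) (P : 'M[R]_n) (pi : 'rV[R]_n).

Lemma mulmx_exp_fix p (v : 'M[R]_(n, p)) k : P *m v = v -> P ^+ k *m v = v.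
Proof.
move=> Pv; elim: k => [|k IHk]; first by rewrite expr0 mul1mx.
by rewrite exprSr -mulmxE -mulmxA Pv.
Qed.

Lemma stationary_exp k : pi *m P = pi -> pi *m P ^+ k = pi.
Proof.
move=> piP; elim: k => [|k IHk]; first by rewrite expr0 mulmx1.
by rewrite exprS -mulmxE mulmxA piP.
Qed.

Lemma stochastic_mul_const p (c : 'rV[R]_p) : stochastic P ->
  P *m (\matrix_(i < n, j < p) c 0 j) = \matrix_(i, j) c 0 j.
Proof.
case=> _ P1; apply/matrixP => i j; rewrite !mxE.
under eq_bigr => k _ do rewrite mxE.
by rewrite -mulr_suml P1 mul1r.
Qed.

Lemma stochastic_exp k : stochastic P -> stochastic (P ^+ k).
Proof.
move=> hP; split=> [|i].
  elim: k => [|k IHk] i j; first by rewrite expr0 mxE ler0n.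
  rewrite exprS -mulmxE mxE; apply: sumr_ge0 => l _.
  by apply: mulr_ge0; [case: hP | apply: IHk].
have /(mulmx_exp_fix k)/matrixP/(_ i 0) := stochastic_mul_const (const_mx 1 : 'rV_1) hP.
by rewrite !mxE => <-; apply: eq_bigr => j _; rewrite !mxE mulr1.
Qed.

(** Maximum principle: the maximal value of [v] is a weighted mean of the values
    reachable from a maximiser, and irreducibility reaches every state. *)
Lemma irreducible_harmonic_const (v : 'cV[R]_n) :
  stochastic P -> irreducible P -> P *m v = v -> forall i j, v i 0 = v j 0.
Proof.
move=> hP irr Pv.
suff maxc (i0 : 'I_n) : exists i, forall j, v i 0 = v j 0.
  by move=> i j; have [k vk] := maxc i; rewrite -(vk i) -(vk j).
have [i _ vmax] := @arg_maxP _ _ _ i0 predT (fun i => v i 0) isT.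
exists i => j; have [k Pij] := irr i j.
have [Pk0 Pk1] := stochastic_exp k hP.
have mean0 : \sum_l (P ^+ k) i l * (v i 0 - v l 0) = 0.
  under eq_bigr => l _ do rewrite mulrBr.
  rewrite sumrB -mulr_suml Pk1 mul1r.
  by have /matrixP/(_ i 0) := mulmx_exp_fix k Pv; rewrite mxE => ->; rewrite subrr.
have term_ge0 l : true -> 0 <= (P ^+ k) i l * (v i 0 - v l 0).
  by move=> _; rewrite mulr_ge0 // subr_ge0; apply: vmax.
have /eqP := psumr_eq0P term_ge0 mean0 (i:=j) isT.
by rewrite mulf_eq0 gt_eqF //= subr_eq0 => /eqP.
Qed.

Lemma distribution_mulmx_Pi p (u : 'M[R]_(p, n)) :
  (forall i, \sum_j u i j = 1) -> u *m Pi_mx pi = \matrix_(i, j) pi 0 j.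
Proof.
move=> u1; apply/matrixP => i j; rewrite !mxE.
under eq_bigr => k _ do rewrite mxE.
by rewrite -mulr_suml u1 mul1r.
Qed.

(** Any stationary [u] is sent to [pi] by [I - P + Pi]; applied to [pi] itself
    and to a competitor, this yields both [pi F = pi] and uniqueness. *)
Lemma stationary_mulmx_inv_fundamental (u : 'rV[R]_n) :
  stationary_distribution P u -> u *m (1%:M - P + Pi_mx pi) = pi.
Proof.
case=> [[_ u1] uP]; rewrite mulmxDr mulmxBr mulmx1 uP subrr add0r.
rewrite distribution_mulmx_Pi => [|i]; last by rewrite ord1.
by apply/rowP => j; rewrite mxE.
Qed.

Hypotheses (hP : stochastic P) (irr : irreducible P).
Hypothesis hpi : stationary_distribution P pi.

Let piP : pi *m P = pi. Proof. by case: hpi. Qed.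
Let pi1 : \sum_i pi 0 i = 1. Proof. by case: hpi => -[]. Qed.

Lemma fundamental_unitmx : 1%:M - P + Pi_mx pi \in unitmx.
Proof.
rewrite -unitmx_tr -row_free_unit; apply: inj_row_free => w.
move=> /(congr1 trmx); rewrite trmx_mul trmxK trmx0.
set v := w^T => Av0.
have piv0 : pi *m v = 0.
  by rewrite -{1}(stationary_mulmx_inv_fundamental hpi) -mulmxA Av0 mulmx0.
have Pi_v0 : Pi_mx pi *m v = 0.
  apply/colP => i; have /colP/(_ 0) := piv0; rewrite !mxE => piv0E.
  by rewrite -[RHS]piv0E; apply: eq_bigr => k _; rewrite mxE.
have Pv : P *m v = v.
  move/eqP: Av0; rewrite mulmxDl mulmxBl mul1mx Pi_v0 addr0 subr_eq0.
  by rewrite eq_sym => /eqP.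
have vc := irreducible_harmonic_const hP irr Pv.
suff v0 : v = 0 by rewrite -[w]trmxK -/v v0 trmx0.
apply/colP => i; rewrite [RHS]mxE.
have /matrixP/(_ 0 0) := piv0; rewrite !mxE.
under eq_bigr => k _ do rewrite (vc k i).
by rewrite -mulr_suml pi1 mul1r mxE.
Qed.

Lemma stationary_mulmx_fundamental (u : 'rV[R]_n) :
  stationary_distribution P u -> pi *m fundamental_mx P pi = u.
Proof.
by move=> /stationary_mulmx_inv_fundamental {1}<-; rewrite mulmxK // fundamental_unitmx.
Qed.

Lemma stationary_unique (u : 'rV[R]_n) : stationary_distribution P u -> u = pi.
Proof.
by move=> /stationary_mulmx_fundamental <-; apply: stationary_mulmx_fundamental.
Qed.

(** [I - P] is singular, and [F] inverts it up to the projection [Pi] onto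
    its kernel. *)
Lemma mulmx_generator_fundamental :
  (1%:M - P) *m fundamental_mx P pi = 1%:M - Pi_mx pi.
Proof.
have PiF : Pi_mx pi *m fundamental_mx P pi = Pi_mx pi.
  apply/matrixP => i j; rewrite !mxE.
  have /rowP/(_ j) := stationary_mulmx_fundamental hpi; rewrite mxE => <-.
  by apply: eq_bigr => k _; rewrite mxE.
by rewrite -[1%:M - P](addrK (Pi_mx pi)) mulmxBl PiF mulmxV ?fundamental_unitmx.
Qed.

Lemma mulmx_exp_fundamental m :
  (1%:M - P ^+ m) *m fundamental_mx P pi = \sum_(0 <= l < m) (P ^+ l - Pi_mx pi).
Proof.
have PPi : P *m Pi_mx pi = Pi_mx pi by apply: stochastic_mul_const.
elim: m => [|m IHm]; first by rewrite big_nil expr0 subrr mul0mx.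
rewrite big_nat_recr //= -IHm.
have -> : 1%:M - P ^+ m.+1 = (1%:M - P ^+ m) + P ^+ m *m (1%:M - P).
  by rewrite mulmxBr mulmx1 exprSr -mulmxE addrA subrK.
rewrite mulmxDl -mulmxA mulmx_generator_fundamental mulmxBr mulmx1.
by rewrite (mulmx_exp_fix _ PPi).
Qed.

Hypothesis hrev : reversible P pi.

Lemma reversible_exp k : reversible (P ^+ k) pi.
Proof.
elim: k => [|k IHk] i j.
  by rewrite expr0 !mxE eq_sym; case: eqP => [->//|_]; rewrite !mulr0.
rewrite [in LHS]exprS exprSr -!mulmxE !mxE !mulr_sumr.
by apply: eq_bigr => l _; rewrite mulrA hrev mulrAC IHk mulrA mulrAC.
Qed.

Lemma mxtrace_diag_mulmx (A B : 'M[R]_n) :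
  \tr (diag_mx pi *m (A *m B)) = \sum_i \sum_j pi 0 i * A i j * B j i.
Proof.
rewrite /mxtrace; apply: eq_bigr => i _; rewrite mul_diag_mx !mxE mulr_sumr.
by apply: eq_bigr => j _; rewrite mulrA.
Qed.

Lemma sum_flow_resistance m :
  \sum_i \sum_j pi 0 j * (P ^+ m) j i * resistance_distance P pi i j
  = 2 * \tr (diag_mx pi *m (\sum_(0 <= l < m) (P ^+ l - Pi_mx pi))).
Proof.
rewrite -mulmx_exp_fundamental mulmxBl mul1mx mulmxBr raddfB /=.
rewrite mxtrace_diag_mulmx /resistance_distance.
set F := fundamental_mx P pi.
pose Q := P ^+ m.
have [_ Q1] := stochastic_exp m hP.
have piQ := stationary_exp m piP.
have trMF : \tr (diag_mx pi *m F) = \sum_i pi 0 i * F i i.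
  by rewrite /mxtrace; apply: eq_bigr => i _; rewrite mul_diag_mx mxE.
have diag_in : \sum_i \sum_j pi 0 j * Q j i * F i i = \tr (diag_mx pi *m F).
  rewrite trMF; apply: eq_bigr => i _; rewrite -mulr_suml.
  by have /rowP/(_ i) := piQ; rewrite mxE => ->.
have diag_out : \sum_i \sum_j pi 0 j * Q j i * F j j = \tr (diag_mx pi *m F).
  rewrite trMF exchange_big; apply: eq_bigr => j _ /=.
  by rewrite -mulr_suml -mulr_sumr Q1 mulr1.
have cross_rev : \sum_i \sum_j pi 0 j * Q j i * F j i
    = \sum_i \sum_j pi 0 i * Q i j * F j i.
  apply: eq_bigr => i _; apply: eq_bigr => j _.
  by rewrite /Q (reversible_exp m i j).
have cross : \sum_i \sum_j pi 0 j * Q j i * F i j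
    = \sum_i \sum_j pi 0 i * Q i j * F j i by rewrite exchange_big.
under eq_bigr => i _.
  under eq_bigr => j _ do rewrite !mulrBr mulrDr.
  rewrite !sumrB big_split /=; over.
rewrite !sumrB big_split /= diag_in diag_out cross cross_rev.
by rewrite mulrBr !mulr_natl !mulr2n opprD addrA.
Qed.

Lemma doubly_stochastic_stationary i : doubly_stochastic P -> pi 0 i = n%:R^-1.
Proof.
move=> [_ cP].
have n0 : n%:R != 0 :> R by rewrite pnatr_eq0 -lt0n (leq_ltn_trans _ (ltn_ord i)).
rewrite -(@stationary_unique (const_mx n%:R^-1)) ?mxE //; split.
  split=> [j|]; first by rewrite mxE invr_ge0 ler0n.
  under eq_bigr => j _ do rewrite mxE.
  by rewrite sumr_const card_ord -[LHS]mulr_natr mulVf.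
apply/rowP => j; rewrite !mxE.
under eq_bigr => k _ do rewrite mxE.
by rewrite -mulr_sumr cP mulr1.
Qed.

Lemma sum_doubly_stochastic_resistance : doubly_stochastic P ->
  \sum_i \sum_j P i j * resistance_distance P pi i j = 2 * (n%:R - 1).
Proof.
move=> dP; have piE i := doubly_stochastic_stationary i dP.
have n0 : n%:R != 0 :> R.
  (* With no state, [pi] would have total mass 0. *)
  rewrite pnatr_eq0; apply/eqP => n0; move: pi1.
  rewrite big1 => [/eqP|[i lt_i_n] _]; first by rewrite eq_sym oner_eq0.
  by have := lt_i_n; rewrite {1}n0.
have := sum_flow_resistance 1; rewrite big_nat1 expr0 expr1 => flow1.
have trE : \tr (diag_mx pi *m (1 - Pi_mx pi)) = 1 - n%:R^-1.
  rewrite /mxtrace; under eq_bigr => i _.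
    rewrite mul_diag_mx !mxE eqxx piE; over.
  by rewrite sumr_const card_ord -[LHS]mulr_natl mulrA mulfV // mul1r.
transitivity (n%:R * (2 * (1 - n%:R^-1 : R))); last first.
  by rewrite mulrCA mulrBr mulr1 mulfV.
rewrite -trE -flow1 mulr_sumr; apply: eq_bigr => i _.
rewrite mulr_sumr; apply: eq_bigr => j _; rewrite -hrev piE.
by rewrite !mulrA mulfV // mul1r.
Qed.

End Chain.

Theorem corollary1p2 (R : realType) (n : nat) (P : 'M[R]_n) (pi : 'rV[R]_n)
    (hP : stochastic P) (hergodic : ergodic P)
    (hpi : stationary_distribution P pi) (hrev : reversible P pi) :
  (forall m : nat, (1 <= m)%N ->
     \sum_(i < n) \sum_(j < n)
        pi 0 j * (P ^+ m) j i * resistance_distance P pi i j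
     = 2 * \tr (diag_mx pi *m (\sum_(0 <= l < m) (P ^+ l - Pi_mx pi))))
  /\
  (doubly_stochastic P ->
     \sum_(i < n) \sum_(j < n) P i j * resistance_distance P pi i j
     = 2 * (n%:R - 1)).
Proof.
have [irr _] := hergodic; split=> [m _|].
  exact: sum_flow_resistance.
exact: sum_doubly_stochastic_resistance.
Qed.
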